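(* Let $\mathbb F$ be a field, let $(G,\psi)$ be an $(\mathbb F^+\rtimes\mathbb F^\times)$-gain graph, and let $D$ be an orientation of $G$. Then the matrix $A(D,\psi)$ represents $M(\mathbb F^+\rtimes\mathbb F^\times,\mathbb F^+,\mathcal A,G,\psi)$ over $\mathbb F$; that is, the vector matroid of $A(D,\psi)$ (on the column set $E(G)$) equals $M(\mathbb F^+\rtimes\mathbb F^\times,\mathbb F^+,\mathcal A,G,\psi)$.
   Context: $\Gamma=\mathbb F^+\rtimes\mathbb F^\times$ is the group on $\mathbb F\times\mathbb F^\times$ with $(a,b)\circ(c,d)=(a+bc,bd)$, identity $\varepsilon=(0,1)$ (equivalently, the affine maps $x\mapsto a+bx$ of $\mathbb F$). $\mathbb F^+$ denotes the normal subgroup $\{(a,1):a\in\mathbb F\}$. $\mathcal A=\{A_x:x\in\mathbb F\}$ where $A_x=\{(a,b):a+bx=x\}$ is the stabilizer of the point $x$; thus $(a,b),(c,d)$ with $b,d\ne1$ lie in the same member of $\mathcal A$ iff $a/(1-b)=c/(1-d)$. Gain graphs: graphs may have loops and parallel edges; a $\Gamma$-gain function $\psi$ maps oriented edges $(e,u,v)$ to $\Gamma$ with $\psi(e,u,v)=\psi(e,v,u)^{-1}$ for $u\ne v$; a cycle is $\psi$-balanced if the product of gains along some simple closed walk around it is $\varepsilon$. $\psi(X)$ is the set of gains of orientations of edges in $X$. Switching: $\psi^\eta(e,u,v)=\eta(u)^{-1}\psi(e,u,v)\eta(v)$. $\psi/\mathbb F^+$ is $\psi$ composed with the quotient $\Gamma\to\Gamma/\mathbb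 F^+$. Frame matroid $F(G,\varphi)$: circuits are balanced cycles, tight handcuffs (two edge-disjoint cycles sharing exactly one vertex) and loose handcuffs (two vertex-disjoint cycles joined by a minimal path) with both cycles unbalanced, and theta graphs with all cycles unbalanced. Construction: $N=F(G,\psi/\mathbb F^+)$; $\mathcal C$ is the set of circuits $C$ of $N$ that are $\psi$-balanced cycles, or handcuffs or theta graphs with $\psi^\eta(C)\subseteq A$ for some switching $\eta$ and $A\in\mathcal A$; $M(\Gamma,\mathbb F^+,\mathcal A,G,\psi)$ is the matroid on $E(G)$ with rank $r_N(X)$ if every circuit of $N|X$ is in $\mathcal C$, and $r_N(X)+1$ otherwise. An orientation $D$ chooses for each edge one oriented edge $(e,v,w)$. $A(D,\psi)$ is the matrix over $\mathbb F$ with rows indexed by $V(G)\cup\{v_0\}$ ($v_0\notin V(G)$) and columns by $E(G)$: if $e$ is oriented in $D$ from $v$ to $w$ and $\psi(e,v,w)=(a,b)$, the entry in row $u$, column $e$ is $a$ if $u=v_0$; $1$ if $u=v\ne w$; $-b$ if $u=w\ne v$; $1-b$ if $u=v=w$; $0$ otherwise. *)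

(* Defs.v *)
From HB Require Import structures.
From mathcomp Require Import all_boot all_order all_algebra boolp.
From mathcomp Require Import generic_quotient.
Set Implicit Arguments.
Unset Strict Implicit.
Unset Printing Implicit Defensive.
Import GRing.Theory.

Record normalSubgroup (gT : groupType) := NormalSubgroup {
  nsub_pred :> {pred gT};
  nsub1 : 1%g \in nsub_pred;
  nsubM : forall x y, x \in nsub_pred -> y \in nsub_pred ->
    (x * y)%g \in nsub_pred;
  nsubV : forall x, x \in nsub_pred -> (x^-1)%g \in nsub_pred;
  nsubJ : forall x y, x \in nsub_pred -> (x ^ y)%g \in nsub_pred
}.

Section QuotientGroup.
Local Open Scope group_scope.
Local Open Scope quotient_scope.
Variables (gT : groupType) (H : normalSubgroup gT).

Definition coset_eq : rel gT := fun x y => x^-1 * y \in nsub_pred H.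

Lemma coset_eq_refl : reflexive coset_eq.
Proof. by move=> x; rewrite /coset_eq mulVg nsub1. Qed.

Lemma coset_eq_sym : symmetric coset_eq.
Proof.
have h x y : coset_eq x y -> coset_eq y x.
  by rewrite /coset_eq => /nsubV; rewrite invgM invgK.
by move=> x y; apply/idP/idP; apply: h.
Qed.

Lemma coset_eq_trans : transitive coset_eq.
Proof.
move=> y x z xy yz; rewrite /coset_eq.
by have := nsubM xy yz; rewrite mulgA mulgK.
Qed.

Canonical coset_equiv :=
  EquivRel coset_eq coset_eq_refl coset_eq_sym coset_eq_trans.

Definition quotient_group : Type := {eq_quot coset_equiv}.
HB.instance Definition _ := Choice.on quotient_group.
HB.instance Definition _ := EqQuotient.on quotient_group.

Definition quotient_proj (x : gT) : quotient_group := \pi_quotient_group x.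

Definition qone : quotient_group := quotient_proj 1.
Definition qinv (x : quotient_group) := quotient_proj (repr x)^-1.
Definition qmul (x y : quotient_group) := quotient_proj (repr x * repr y).

Lemma quotient_projP x y :
  reflect (quotient_proj x = quotient_proj y) (coset_eq x y).
Proof. by apply: (iffP idP) => [xy|/eqquotP//]; apply/eqquotP. Qed.

Lemma repr_proj x : coset_eq (repr (quotient_proj x)) x.
Proof. by apply/quotient_projP; rewrite /quotient_proj reprK. Qed.

Lemma quotient_projV x : qinv (quotient_proj x) = quotient_proj x^-1.
Proof.
apply/quotient_projP; rewrite /coset_eq invgK.
have := repr_proj x; rewrite coset_eq_sym => /(nsubJ x^-1).
by rewrite /conjg invgK !mulgA mulgV mul1g.
Qed.

Lemma quotient_projM x y :
  qmul (quotient_proj x) (quotient_proj y) = quotient_proj (x * y).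
Proof.
apply/quotient_projP; rewrite /coset_eq invgM.
have := nsubM (nsubJ (repr (quotient_proj y)) (repr_proj x)) (repr_proj y).
by rewrite /conjg !mulgA mulgK.
Qed.

Lemma qmulA : associative qmul.
Proof.
move=> x y z; rewrite -[x]reprK -[y]reprK -[z]reprK.
by rewrite -!/(quotient_proj _) !quotient_projM mulgA.
Qed.

Lemma qmul1g : left_id qone qmul.
Proof. by move=> x; rewrite -[x]reprK -!/(quotient_proj _) quotient_projM mul1g. Qed.

Lemma qmulg1 : right_id qone qmul.
Proof. by move=> x; rewrite -[x]reprK -!/(quotient_proj _) quotient_projM mulg1. Qed.

Lemma qmulVg : left_inverse qone qinv qmul.
Proof.
move=> x; rewrite -[x]reprK -!/(quotient_proj _) quotient_projV.
by rewrite quotient_projM mulVg.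
Qed.

Lemma qmulgV : right_inverse qone qinv qmul.
Proof.
move=> x; rewrite -[x]reprK -!/(quotient_proj _) quotient_projV.
by rewrite quotient_projM mulgV.
Qed.

HB.instance Definition _ := isGroup.Build quotient_group
  qmulA qmul1g qmulg1 qmulVg qmulgV.

End QuotientGroup.

Record multigraph (V E : finType) := Multigraph {
  ends : E -> {set V};
  _ : forall e, 0 < #|ends e| <= 2
}.

(* The triple (e, u, v) stands for the edge e oriented from u to v; only those
   with [is_oriented] are genuine, and a loop has a single orientation. *)
Definition oriented_edge (V E : finType) : Type := (E * V * V)%type.

Section Graphs.
Variables (V E : finType) (G : multigraph V E).
Local Notation oedge := (oriented_edge V E).
Implicit Types (d : oedge) (p : seq oedge) (C P X : {set E}) (u v : V).

Definition edge_of d : E := d.1.1.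
Definition tail d : V := d.1.2.
Definition head d : V := d.2.

Definition is_oriented d := ends G (edge_of d) == [set tail d; head d].

Definition vertices X : {set V} := \bigcup_(e in X) ends G e.

Fixpoint walk u p v : bool :=
  if p is d :: p' then [&& is_oriented d, tail d == u & walk (head d) p' v]
  else u == v.

(* Distinctness of the edges matters for length 2 only. *)
Definition simple_closed_walk p : Prop :=
  [/\ p != [::], exists u, walk u p u, uniq (map tail p)
    & uniq (map edge_of p)].

Definition walk_edges p : {set E} := [set e in map edge_of p].

Definition is_cycle C : Prop :=
  exists2 p, simple_closed_walk p & walk_edges p = C.

Definition is_path u v P : Prop :=
  exists p, [/\ walk u p v, uniq (u :: map head p) & walk_edges p = P].

Definition tight_handcuff C1 C2 C : Prop :=
  [/\ is_cycle C1, is_cycle C2, [disjoint C1 & C2],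
      #|vertices C1 :&: vertices C2| = 1 & C = C1 :|: C2].

Definition joining_path C1 C2 P : Prop :=
  exists u v, [/\ u \in vertices C1, v \in vertices C2 & is_path u v P].

Definition loose_handcuff C1 C2 C : Prop :=
  exists P,
  [/\ is_cycle C1 /\ is_cycle C2, [disjoint vertices C1 & vertices C2],
      joining_path C1 C2 P,
      forall Q, joining_path C1 C2 Q -> Q \subset P -> Q = P
    & C = C1 :|: C2 :|: P].

Definition handcuff C1 C2 C : Prop :=
  tight_handcuff C1 C2 C \/ loose_handcuff C1 C2 C.

Definition is_handcuff C : Prop := exists C1 C2, handcuff C1 C2 C.

Definition is_theta C : Prop :=
  exists u v (P : 'I_3 -> {set E}),
  [/\ u != v, forall i, is_path u v (P i),
      forall i j, i != j -> [disjoint P i & P j],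
      forall i j, i != j -> vertices (P i) :&: vertices (P j) = [set u; v]
    & C = \bigcup_i P i].

Definition is_orientation (D : E -> V * V) : Prop :=
  forall e, is_oriented (e, (D e).1, (D e).2).

Section Gains.
Variable gT : groupType.

Definition is_gain_function (psi : oedge -> gT) : Prop :=
  forall e u v, is_oriented (e, u, v) -> u != v ->
    psi (e, u, v) = ((psi (e, v, u))^-1)%g.

Definition balanced_cycle (psi : oedge -> gT) C : Prop :=
  exists p, [/\ simple_closed_walk p, walk_edges p = C
              & (\prod_(d <- p) psi d)%g = 1%g].

Definition switch (eta : V -> gT) (psi : oedge -> gT) : oedge -> gT :=
  fun d => ((eta (tail d))^-1 * psi d * eta (head d))%g.

Definition frame_circuit (phi : oedge -> gT) C : Prop :=
  [\/ balanced_cycle phi C,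
      exists C1 C2, [/\ handcuff C1 C2 C, ~ balanced_cycle phi C1
                      & ~ balanced_cycle phi C2]
    | is_theta C /\
      forall C', is_cycle C' -> C' \subset C -> ~ balanced_cycle phi C'].

End Gains.

(* Matroids on E are compared through their rank functions; this is the rank
   function of the matroid with the given collection of circuits. *)
Definition circuit_rank (circuit : {set E} -> Prop) X : nat :=
  \max_(I : {set E} |
        (I \subset X) && `[< forall C, circuit C -> ~~ (C \subset I) >]) #|I|.

Section Construction.
Variables (gT : groupType) (H : normalSubgroup gT) (A : {pred gT} -> Prop).
Variable psi : oedge -> gT.

Definition quotient_gain : oedge -> quotient_group H :=
  fun d => quotient_proj H (psi d).

Definition N_circuit : {set E} -> Prop := frame_circuit quotient_gain.
Definition N_rank : {set E} -> nat := circuit_rank N_circuit.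

Definition selected_circuit C : Prop :=
  N_circuit C /\
  (balanced_cycle psi C \/
   (is_handcuff C \/ is_theta C) /\
   exists (eta : V -> gT) (S : {pred gT}), A S /\
     forall d, is_oriented d -> edge_of d \in C -> switch eta psi d \in S).

Definition M_rank X : nat :=
  if `[< forall C, N_circuit C -> C \subset X -> selected_circuit C >]
  then N_rank X else (N_rank X).+1.

End Construction.
End Graphs.

Section AffineGroup.
Local Open Scope ring_scope.
Variable F : fieldType.

Definition affine : Type := {ab : F * F | ab.2 != 0}.
HB.instance Definition _ := Choice.on affine.
Implicit Types x y z : affine.

Definition trans_part x : F := (val x).1.
Definition mult_part x : F := (val x).2.

Lemma mult_part_neq0 x : mult_part x != 0. Proof. by case: x. Qed.

Definition mk_affine (a b : F) (nz : b != 0) : affine :=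
  exist (fun ab : F * F => ab.2 != 0) (a, b) nz.

Definition aff_one : affine := mk_affine 0 (oner_neq0 F).

Lemma aff_mul_subproof x y : mult_part x * mult_part y != 0.
Proof. by rewrite mulf_neq0 ?mult_part_neq0. Qed.

Definition aff_mul x y : affine :=
  mk_affine (trans_part x + mult_part x * trans_part y) (aff_mul_subproof x y).

Lemma aff_inv_subproof x : (mult_part x)^-1 != 0.
Proof. by rewrite invr_neq0 ?mult_part_neq0. Qed.

Definition aff_inv x : affine :=
  mk_affine (- ((mult_part x)^-1 * trans_part x)) (aff_inv_subproof x).

Lemma aff_eq x y :
  trans_part x = trans_part y -> mult_part x = mult_part y -> x = y.
Proof.
case: x y => [[a b] nb] [[c d] nd]; rewrite /trans_part /mult_part /= => ac bd.
by apply/val_inj; rewrite /= ac bd.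
Qed.

Lemma aff_mulA : associative aff_mul.
Proof.
move=> x y z; apply: aff_eq; rewrite /trans_part /mult_part /=.
  by rewrite mulrDr addrA mulrA.
by rewrite mulrA.
Qed.

Lemma aff_mul1g : left_id aff_one aff_mul.
Proof.
by move=> x; apply: aff_eq; rewrite /trans_part /mult_part /= mul1r ?add0r.
Qed.

Lemma aff_mulg1 : right_id aff_one aff_mul.
Proof.
move=> x; apply: aff_eq; rewrite /trans_part /mult_part /=.
  by rewrite mulr0 addr0.
by rewrite mulr1.
Qed.

Lemma aff_mulVg : left_inverse aff_one aff_inv aff_mul.
Proof.
move=> x; apply: aff_eq; rewrite /trans_part /mult_part /=.
  by rewrite addNr.
by rewrite mulVf ?mult_part_neq0.
Qed.

Lemma aff_mulgV : right_inverse aff_one aff_inv aff_mul.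
Proof.
move=> x; apply: aff_eq; rewrite /trans_part /mult_part /=.
  by rewrite mulrN mulrA mulfV ?mult_part_neq0// mul1r subrr.
by rewrite mulfV ?mult_part_neq0.
Qed.

HB.instance Definition _ := isGroup.Build affine
  aff_mulA aff_mul1g aff_mulg1 aff_mulVg aff_mulgV.

Lemma mult_partM x y : mult_part (x * y)%g = mult_part x * mult_part y.
Proof. by []. Qed.

Lemma mult_partV x : mult_part (x^-1)%g = (mult_part x)^-1.
Proof. by []. Qed.

Definition translation_pred : {pred affine} := [pred x | mult_part x == 1].

Lemma translation1 : 1%g \in translation_pred.
Proof. by rewrite inE. Qed.

Lemma translationM x y : x \in translation_pred -> y \in translation_pred ->
  (x * y)%g \in translation_pred.
Proof. by rewrite !inE mult_partM => /eqP-> /eqP->; rewrite mulr1. Qed.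

Lemma translationV x :
  x \in translation_pred -> (x^-1)%g \in translation_pred.
Proof. by rewrite !inE mult_partV => /eqP->; rewrite invr1. Qed.

Lemma translationJ x y :
  x \in translation_pred -> (x ^ y)%g \in translation_pred.
Proof.
rewrite !inE /conjg !mult_partM mult_partV => /eqP->.
by rewrite mul1r mulVf ?mult_part_neq0.
Qed.

Definition translations : normalSubgroup affine :=
  NormalSubgroup translation1 translationM translationV translationJ.

Definition stabilizer (x : F) : {pred affine} :=
  [pred g | trans_part g + mult_part g * x == x].

Definition point_stabilizers (S : {pred affine}) : Prop :=
  exists x : F, S = stabilizer x.

End AffineGroup.

Section Representation.
Local Open Scope ring_scope.
Variables (F : fieldType) (V E : finType).

(* [None] is the extra row v_0. *)
Definition gain_entry (D : E -> V * V) (psi : oriented_edge V E -> affine F)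
    (r : option V) (e : E) : F :=
  let: (v, w) := D e in
  let a := trans_part (psi (e, v, w)) in
  let b := mult_part (psi (e, v, w)) in
  if r is Some u then
    if v == w then (if u == v then 1 - b else 0)
    else if u == v then 1
    else if u == w then - b
    else 0
  else a.

Definition gain_matrix D psi : 'M[F]_(#|{: option V}|, #|E|) :=
  \matrix_(i, j) gain_entry D psi (enum_val i) (enum_val j).

(* Rank function of the vector matroid on E: rank of the columns in X. *)
Definition vector_rank (m : nat) (B : 'M[F]_(m, #|E|)) (X : {set E}) : nat :=
  \rank (colsub (fun j : 'I_#|X| => enum_rank (enum_val j)) B).

Definition represents (m : nat) (B : 'M[F]_(m, #|E|)) (r : {set E} -> nat) :=
  forall X : {set E}, vector_rank B X = r X.

End Representation.

(* Main.v *)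
Require Import Defs.
From mathcomp Require Import all_boot all_order all_algebra boolp.
(* Makes [head] denote the head of an oriented edge rather than [seq.head]. *)
Import Defs.
Set Implicit Arguments.
Unset Strict Implicit.
Unset Printing Implicit Defensive.
Import GRing.Theory.

(** Delete the row [v_0] from [A(D,psi)].  What remains represents [N]:
    handcuffs and thetas have more edges than vertices and a balanced cycle has
    a nonzero left kernel vector, so circuits of [N] are dependent; conversely,
    at every vertex the support of a linear dependency has at least two edges,
    unless it contains a balanced loop, so following edges outside an unbalanced
    cycle closes up into a handcuff or a theta.  Restoring the row [v_0] raises
    the rank of the columns [X] unless that row, restricted to [X], is spanned
    by the others.  By circuit elimination this can be tested on the circuits
    [C] of [N] inside [X], where spanning means that there is a potential
    [y : V -> F] with [psi(e,v,w)] mapping [y w] to [y v] along [C].  Switching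
    by the translations [y v] puts the gains in the stabilizer of [0]; on a
    cycle whose gain is a translation, a potential forces that gain to be the
    identity. *)

(** * Column dependencies, ranks and circuits *)

Section ColumnDependence.
Local Open Scope ring_scope.
Variable F : fieldType.

(** Entries come from a function on labels, so that restricting to a set of rows or columns keeps
    the labels and transposing swaps the arguments of [f]. *)
Definition submat (R E : finType) (f : R -> E -> F) (W : {pred R})
    (X : {pred E}) : 'M[F]_(#|W|, #|X|) :=
  \matrix_(i, j) f (enum_val i) (enum_val j).

Definition dependent (R E : finType) (f : R -> E -> F) (W : {pred R})
    (X : {pred E}) : Prop :=
  exists2 z : E -> F, (exists2 e, e \in X & z e != 0)
    & forall v, v \in W -> \sum_(e in X) f v e * z e = 0.

Lemma submat_tr (R E : finType) (f : R -> E -> F) W X :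
  (submat f W X)^T = submat (fun e v => f v e) X W.
Proof. by apply/matrixP=> i j; rewrite !mxE. Qed.

Lemma dependentP (R E : finType) (f : R -> E -> F) W X :
  dependent f W X <-> (\rank (submat f W X) < #|X|)%N.
Proof.
have -> : (\rank (submat f W X) < #|X|)%N = ~~ row_free (submat f W X)^T.
  by rewrite /row_free mxrank_tr ltn_neqAle rank_leq_col andbT.
split=> [[z [e eX nze] z0]|].
  apply/negP => /row_freeP [B MB].
  pose u : 'rV[F]_#|X| := \row_j z (enum_val j).
  have u0 : u *m (submat f W X)^T = 0.
    apply/rowP => i; rewrite !mxE.
    under eq_bigr do rewrite !mxE mulrC.
    by rewrite -[LHS](big_enum_val (A := X) (fun e => f (enum_val i) e * z e))
               z0 // enum_valP.
  have : u = 0 by rewrite -[u]mulmx1 -MB mulmxA u0 mul0mx.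
  move/rowP/(_ (enum_rank_in eX e)); rewrite !mxE enum_rankK_in // => ze0.
  by rewrite ze0 eqxx in nze.
rewrite -kermx_eq0 => /matrix0Pn [i [j nz]].
(* A nonzero row of the kernel gives the dependency; its values off [X] are defaults of
   [enum_rank_in] and never enter the sums. *)
pose u := row i (kermx (submat f W X)^T).
have u0 : u *m (submat f W X)^T = 0 by apply/sub_kermxP/row_sub.
exists (fun e => u 0 (enum_rank_in (enum_valP j) e)).
  by exists (enum_val j); rewrite ?enum_valP // enum_valK_in /u mxE.
move=> v vW; rewrite big_enum_val /=.
move/rowP/(_ (enum_rank_in vW v)): u0; rewrite !mxE => uv; rewrite -[RHS]uv.
by apply: eq_bigr => k _; rewrite enum_valK_in !mxE enum_rankK_in // mulrC.
Qed.

Lemma dependent_card (R E : finType) (f : R -> E -> F) W X :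
  (#|W| < #|X|)%N -> dependent f W X.
Proof. by move=> WX; apply/dependentP; apply: leq_ltn_trans (rank_leq_row _) WX. Qed.

(** Row rank equals column rank, so a relation among the rows keeps the rank below [#|W|]. On a
    cycle, where both sizes agree, this trades column dependencies for vertex potentials and
    back. *)
Lemma dependent_tr (R E : finType) (f : R -> E -> F) W X :
  (#|W| <= #|X|)%N -> dependent (fun e v => f v e) X W -> dependent f W X.
Proof.
move=> WX /dependentP; rewrite -submat_tr mxrank_tr => lt.
by apply/dependentP; apply: leq_trans lt WX.
Qed.

Lemma dependentS (R E : finType) (f : R -> E -> F) W (X Y : {set E}) :
  X \subset Y -> dependent f W X -> dependent f W Y.
Proof.
move=> /subsetP XY [z [e eX nz] z0].
exists (fun e => if e \in X then z e else 0).
  by exists e; rewrite ?XY ?eX.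
move=> v /z0 sv; rewrite -[RHS]sv [LHS]big_mkcond [RHS]big_mkcond; apply: eq_bigr => e' _.
by have [/XY->//|_] := boolP (e' \in X); case: ifP => // _; rewrite mulr0.
Qed.

Lemma rank_submatS (R E : finType) (f : R -> E -> F) W (X Y : {set E}) :
  X \subset Y -> (\rank (submat f W X) <= \rank (submat f W Y))%N.
Proof.
move=> /subsetP XY; rewrite -mxrank_tr -[leqRHS]mxrank_tr; apply: mxrankS.
apply/row_subP => i; have iY := XY _ (enum_valP i).
have -> : row i (submat f W X)^T = row (enum_rank_in iY (enum_val i)) (submat f W Y)^T.
  by apply/rowP => k; rewrite !mxE enum_rankK_in.
exact: row_sub.
Qed.

(** A maximal free family of rows of the transpose is a column basis. *)
Lemma exists_basis (R E : finType) (f : R -> E -> F) W (X : {set E}) :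
  exists I : {set E}, [/\ I \subset X, \rank (submat f W I) = #|I|
    & \rank (submat f W X) = #|I|].
Proof.
set M := (submat f W X)^T.
pose g := fun i : 'I_(\rank M) => enum_val (maxrankfun M i).
have g_inj : injective g by move=> i j /enum_val_inj /maxrankfun_inj.
pose I := [set g i | i in 'I_(\rank M)].
have IX : I \subset X by apply/subsetP => _ /imsetP [i _ ->]; apply: enum_valP.
have cI : #|I| = \rank M by rewrite card_imset // card_ord.
have rM : \rank (submat f W X) = \rank M by rewrite mxrank_tr.
exists I; split=> //; last by rewrite rM cI.
apply/eqP; rewrite eqn_leq rank_leq_col -[leqRHS]mxrank_tr.
apply: leq_trans (eq_leq cI) _.
rewrite -(eq_maxrowsub M); apply: mxrankS; apply/row_subP => i.
have gI : g i \in I by apply: imset_f.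
have -> : row i (rowsub (maxrankfun M) M) = row (enum_rank_in gI (g i)) (submat f W I)^T.
  by apply/rowP => k; rewrite !mxE enum_rankK_in.
exact: row_sub.
Qed.

(** The two hypotheses make the circuit-free sets exactly the independent column sets, and a column
    basis of [X] is a largest one. *)
Lemma circuit_rankE (R E : finType) (f : R -> E -> F) (W : {pred R})
    (circuit : {set E} -> Prop) :
  (forall C, circuit C -> dependent f W C) ->
  (forall X : {set E}, dependent f W X -> exists2 C, circuit C & C \subset X) ->
  forall X, circuit_rank circuit X = \rank (submat f W X).
Proof.
move=> circ_dep dep_circ X.
have freeP (I : {set E}) : reflect (\rank (submat f W I) = #|I|)
    `[< forall C, circuit C -> ~~ (C \subset I) >].
  apply: (iffP (asboolP _)) => [free|rI C /circ_dep depC].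
    apply/eqP; rewrite eqn_leq rank_leq_col leqNgt /=; apply/negP.
    by move=> /dependentP /dep_circ [C /free /negP].
  apply/negP => CI; have /dependentP := dependentS CI depC.
  by rewrite rI ltnn.
have [I [IX rI rX]] := exists_basis f W X.
apply/eqP; rewrite eqn_leq; apply/andP; split.
  apply/bigmax_leqP => J /andP [JX /freeP <-]; exact: rank_submatS.
rewrite rX; apply: (leq_bigmax_cond (F := fun I : {set E} => #|I|)).
by rewrite IX; apply/freeP.
Qed.

End ColumnDependence.

(** * The effect of one additional row on the rank *)

Section ExtraRow.
Local Open Scope ring_scope.
Variables (F : fieldType) (V E : finType) (f : option V -> E -> F).

Let g v e := f (Some v) e.

Definition top_row_spanned (X : {set E}) : Prop :=
  exists y : V -> F, forall e, e \in X -> f None e = \sum_v y v * g v e.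

(** On the support of [z] the top row combines rows that all annihilate [z]; exchange the two
    sums. *)
Lemma top_row_spanned_orth (X : {set E}) (z : E -> F) : top_row_spanned X ->
  (forall e, e \notin X -> z e = 0) ->
  (forall v, \sum_e g v e * z e = 0) -> \sum_e f None e * z e = 0.
Proof.
move=> [y fy] zX z0.
have -> : \sum_e f None e * z e = \sum_e \sum_v y v * (g v e * z e).
  apply: eq_bigr => e _; have [/fy->|/zX->] := boolP (e \in X).
    by rewrite mulr_suml; apply: eq_bigr => v _; rewrite mulrA.
  by rewrite mulr0 big1 // => v _; rewrite !mulr0.
rewrite exchange_big big1 // => v _; by rewrite -mulr_sumr z0 mulr0.
Qed.

Definition top_row (X : {set E}) : 'rV[F]_#|X| := \row_j f None (enum_val j).

Lemma top_row_spannedP (X : {set E}) :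
  reflect (top_row_spanned X) (top_row X <= submat g V X)%MS.
Proof.
apply: (iffP submxP) => [[D aD]|[y fy]].
  exists (fun v => D 0 (enum_rank v)) => e eX.
  move/rowP/(_ (enum_rank_in eX e)): aD; rewrite !mxE enum_rankK_in // => ->.
  rewrite [RHS](big_enum_val (A := V) (fun v => D 0 (enum_rank v) * g v e)).
  by apply: eq_bigr => i _; rewrite !mxE enum_rankK_in // enum_valK.
exists (\row_i y (enum_val i)); apply/rowP => j; rewrite !mxE fy ?enum_valP //.
rewrite [LHS](big_enum_val (A := V) (fun v => y v * g v (enum_val j))).
by apply: eq_bigr => i _; rewrite !mxE.
Qed.

Lemma rank_extra_row (X : {set E}) :
  \rank (submat f {: option V} X) =
  if `[< top_row_spanned X >] then \rank (submat g V X)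
  else (\rank (submat g V X)).+1.
Proof.
pose a := top_row X.
have -> : \rank (submat f {: option V} X) = \rank (submat g V X + a)%MS.
  apply: eqmx_rank; apply/andP; split.
    apply/row_subP => i; case ri: (enum_val i) => [v|].
      apply: submx_trans (addsmxSl _ _).
      have -> : row i (submat f {: option V} X) = row (enum_rank v) (submat g V X).
        by apply/rowP => j; rewrite !mxE enum_rankK ri.
      exact: row_sub.
    apply: submx_trans (addsmxSr _ _).
    suff -> : row i (submat f {: option V} X) = a by [].
    by apply/rowP => j; rewrite !mxE ri.
  rewrite addsmx_sub; apply/andP; split; last first.
    have -> : a = row (enum_rank (None : option V)) (submat f {: option V} X).
      by apply/rowP => j; rewrite !mxE enum_rankK.
    exact: row_sub.
  apply/row_subP => i.
  have -> : row i (submat g V X) = row (enum_rank (Some (enum_val i))) (submat f {: option V} X).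
    by apply/rowP => j; rewrite !mxE enum_rankK.
  exact: row_sub.
case: asboolP => [/top_row_spannedP sa|/top_row_spannedP nsa].
  by rewrite (addsmx_idPl sa).
have ra : \rank a = 1%N.
  rewrite rank_rV; case: eqP => // a0; by case/negP: nsa; rewrite -/a a0 sub0mx.
rewrite mxrank_disjoint_sum ?ra ?addn1 //.
(* Since [a] has rank one, a nonzero intersection with the row space would contain [a]. *)
apply/eqP; rewrite -mxrank_eq0; apply: contraR nsa => rc.
have : \rank (submat g V X :&: a)%MS == \rank a.
  by rewrite eqn_leq (mxrankS (capmxSr _ _)) ra lt0n.
by rewrite (mxrank_leqif_sup (capmxSr _ _)) => /submx_trans -> //; apply: capmxSl.
Qed.

(** The cokernel detects rows outside the row space: some column of it is killed by all the other
    rows but not by the top row. *)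
Lemma top_row_not_spanned (X : {set E}) : ~ top_row_spanned X ->
  exists z : E -> F, [/\ forall e, e \notin X -> z e = 0,
    forall v, \sum_e g v e * z e = 0 & \sum_e f None e * z e != 0].
Proof.
move=> nX; pose M := submat g V X.
have : ~~ (top_row X <= M)%MS by apply/negP => /top_row_spannedP.
rewrite submxE => /rV0Pn [j nz].
pose h (k : 'I_#|X|) := cokermx M k j.
(* At most one summand is nonzero: [z] is [h] carried over to [E] and extended by zero off [X]. *)
pose z e := \sum_k (if enum_val k == e then h k else 0).
have zE k : z (enum_val k) = h k.
  by rewrite /z -big_mkcond (big_pred1 k) // => i; rewrite /= (inj_eq enum_val_inj).
have z0 e : e \notin X -> z e = 0.
  move=> eX; rewrite /z big1 // => k _; case: eqP => // ke.
  by rewrite -ke enum_valP in eX.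
have sumE (c : E -> F) : \sum_e c e * z e = \sum_k c (enum_val k) * h k.
  rewrite (bigID (mem X)) /= [X in _ + X]big1 ?addr0; last by move=> e /z0->; rewrite mulr0.
  by rewrite big_enum_val; apply: eq_bigr => k _; rewrite zE.
exists z; split=> // [v|].
  have /matrixP/(_ (enum_rank v) j) := mulmx_coker M.
  rewrite sumE mxE [X in _ = X]mxE => vj; rewrite -[RHS]vj.
  by apply: eq_bigr => k _; rewrite [M _ _]mxE enum_rankK.
apply: contraNneq nz; rewrite sumE => s0; rewrite mxE -[X in _ == X]s0.
by apply/eqP/eq_bigr => k _; rewrite [top_row _ _ _]mxE.
Qed.

Variable circuit : {set E} -> Prop.
Hypothesis circuit_dep : forall C, circuit C -> dependent g V C.
Hypothesis dep_circuit : forall X : {set E},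
  dependent g V X -> exists2 C, circuit C & C \subset X.

(** Circuit elimination in linear form, by induction on the support of [z]: a circuit inside the
    support is either not spanned, or its dependency can be used to cancel an entry of [z]. *)
Lemma circuit_not_spanned (z : E -> F) : (forall v, \sum_e g v e * z e = 0) ->
  \sum_e f None e * z e != 0 ->
  exists C, [/\ circuit C, C \subset [set e | z e != 0] & ~ top_row_spanned C].
Proof.
have [n] := ubnP #|[set e | z e != 0]|; elim: n z => // n IH z le_n z0 az.
set S := [set e | z e != 0] in le_n *.
have dS : dependent g V S.
  exists z => [|v _].
    have [e] : exists e, z e != 0.
      apply/existsP; apply: contraNT az => /existsPn h; apply/eqP; apply: big1 => e _.
      by have := h e; rewrite negbK => /eqP->; rewrite mulr0.
    by exists e; rewrite ?inE.
  rewrite -[RHS](z0 v) [RHS](bigID (mem S)) /= [X in _ = _ + X]big1 ?addr0 //.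
  by move=> e; rewrite inE negbK => /eqP->; rewrite mulr0.
have [C cC CS] := dep_circuit dS.
have [t0 [e0 e0C nt] t0C] := circuit_dep cC.
pose t e := if e \in C then t0 e else 0.
have tker v : \sum_e g v e * t e = 0.
  rewrite -[RHS](t0C v) // [RHS]big_mkcond; apply: eq_bigr => e _; rewrite /t.
  by case: ifP => // _; rewrite mulr0.
have te0 : t e0 != 0 by rewrite /t e0C.
have tC e : e \notin C -> t e = 0 by rewrite /t => /negPf->.
have [sC|] := pselect (top_row_spanned C); last by exists C.
have at0 := top_row_spanned_orth sC tC tker.
(* Subtracting a multiple of [t] keeps the pairing with the top row and shrinks
   the support. *)
pose c := z e0 / t e0; pose w e := z e - c * t e.
have sumw (h : E -> F) : \sum_e h e * t e = 0 -> \sum_e h e * w e = \sum_e h e * z e.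
  move=> h0; under eq_bigr do rewrite /w mulrBr mulrCA.
  by rewrite sumrB -mulr_sumr h0 mulr0 subr0.
have wz : [set e | w e != 0] \proper S.
  apply/properP; split.
    apply/subsetP => e; rewrite !inE; apply: contraNN => /eqP ze.
    have eC : e \notin C.
      by apply/negP => /(subsetP CS); rewrite inE ze eqxx.
    by rewrite /w ze tC // mulr0 subrr.
  exists e0; first exact: (subsetP CS).
  by rewrite inE negbK /w /c divfK // subrr.
have [||| C' [cC' sC' nC']] := IH w; first exact: leq_trans (proper_card wz) _.
- by move=> v; rewrite sumw.
- by rewrite sumw.
by exists C'; split=> //; apply: subset_trans sC' (proper_sub wz).
Qed.

(** The right-hand side has the shape of [M_rank]. If the top row is not spanned on [X], a kernel
    vector supported in [X] witnesses it, and its support contains an unspanned circuit. *)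
Lemma rank_circuits (X : {set E}) :
  \rank (submat f {: option V} X) =
  if `[< forall C, circuit C -> C \subset X -> top_row_spanned C >]
  then circuit_rank circuit X else (circuit_rank circuit X).+1.
Proof.
rewrite rank_extra_row (circuit_rankE circuit_dep dep_circuit).
congr (if _ then _ else _); apply: asbool_equiv_eq; split=> [[y fy] C _ /subsetP CX|h].
  by exists y => e /CX; apply: fy.
apply: contrapT => /top_row_not_spanned [z [zX z0 az]].
have [C [cC Cz]] := circuit_not_spanned z0 az; apply; apply: h => //.
apply: subset_trans Cz _; apply/subsetP => e; rewrite inE.
by apply: contraNT => /zX ->.
Qed.

End ExtraRow.

(** * Walks, paths and cycles *)

Section Walks.
Variables (V E : finType) (G : multigraph V E).
Local Notation oedge := (oriented_edge V E).
Local Notation tails := (map (@tail V E)).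
Local Notation heads := (map (@head V E)).
Local Notation edges := (map (@edge_of V E)).
Implicit Types (d : oedge) (p q : seq oedge) (C P X Y : {set E}) (u v w x : V).

Lemma walk_cat u p q v :
  walk G u (p ++ q) v <-> exists2 w, walk G u p w & walk G w q v.
Proof.
elim: p u => [|d p IH] u /=.
  by split=> [|[w /eqP->]] //; exists u.
split=> [/and3P [-> -> /IH [w pw qw]]|[w /and3P [-> -> pw] qw]].
  by exists w.
by rewrite /=; apply/IH; exists w.
Qed.

Lemma walk_rcons u p d v :
  walk G u (rcons p d) v = [&& walk G u p (tail d), is_oriented G d & head d == v].
Proof.
elim: p u => [|d' p IH] u /=; last by rewrite IH !andbA.
by rewrite [tail d == u]eq_sym andbCA.
Qed.

(** Converts between the vertex list of a path, given by heads, and that of a closed walk, given by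
    tails. *)
Lemma walk_heads u p v :
  walk G u p v -> u :: heads p = rcons (tails p) v.
Proof.
elim: p u => [|d p IH] u /=; first by move=> /eqP->.
by move=> /and3P [_ /eqP-> /IH ->].
Qed.

Lemma walk_oriented u p v d : walk G u p v -> d \in p -> is_oriented G d.
Proof.
elim: p u => [|d' p IH] u //= /and3P [od _ pw].
by rewrite inE => /predU1P [->|/(IH _ pw)].
Qed.

Lemma walk_split u p v x : walk G u p v -> x \in tails p ->
  exists p1 d p2, [/\ p = p1 ++ d :: p2, walk G u p1 x & walk G x (d :: p2) v].
Proof.
move=> pw /mapP [d dp ->]; case/splitPr: dp pw => p1 p2 /walk_cat [w w1 w2].
by exists p1, d, p2; split=> //; case/and3P: w2 (w2) w1 => _ /eqP->.
Qed.

Definition flip d : oedge := (edge_of d, head d, tail d).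

Lemma flip_oriented d : is_oriented G (flip d) = is_oriented G d.
Proof. by rewrite /is_oriented /flip /edge_of /tail /head /= setUC. Qed.

Lemma walk_rev u p v : walk G u p v -> walk G v (rev (map flip p)) u.
Proof.
elim: p u => [|d p IH] u /=; first by rewrite eq_sym.
move=> /and3P [od /eqP tu /IH pw].
by rewrite rev_cons walk_rcons flip_oriented od pw /= -tu.
Qed.

(** Both triples have the same set of ends, so their tails and heads agree either directly or
    crosswise. *)
Lemma oriented_eqVflip d d' : is_oriented G d -> is_oriented G d' ->
  edge_of d' = edge_of d -> d' = d \/ d' = flip d.
Proof.
case: d d' => [[e t] h] [[e' t'] h']; rewrite /is_oriented /flip /edge_of /tail /head /=.
move=> /eqP ee /eqP th ed; move: th; rewrite ed ee => th.
have tt : t \in [set t'; h'] by rewrite -th set21.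
have hh : h \in [set t'; h'] by rewrite -th set22.
have: t' \in [set t; h] by rewrite th set21.
have: h' \in [set t; h] by rewrite th set22.
move: tt hh; rewrite !inE.
by do 4![case/pred2P=> ?]; subst; auto.
Qed.

Lemma orientation_at e x : x \in ends G e ->
  exists d, [/\ is_oriented G d, edge_of d = e & tail d = x].
Proof.
case: G => ends' ends2 /= xe.
have [y xy] : exists y, ends' e = [set x; y].
  have /andP [_] := ends2 e; rewrite (cardsD1 x) xe add1n ltnS.
  rewrite leq_eqVlt ltnS leqn0 => /orP [/cards1P [y ey]|/eqP/cards0_eq e0];
    [exists y | exists x].
    by rewrite -(setD1K xe) ey.
  by rewrite -(setD1K xe) e0 setU0 setUid.
by exists (e, x, y); split=> //; rewrite /is_oriented /= xy.
Qed.

Lemma ends_inhabited e : exists x, x \in ends G e.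
Proof.
by apply/set0Pn; rewrite -card_gt0; case: G => h h' /=; case/andP: (h' e).
Qed.

Lemma verticesU X Y : vertices G (X :|: Y) = vertices G X :|: vertices G Y.
Proof. exact: bigcup_setU. Qed.

Lemma vertices1 e : vertices G [set e] = ends G e.
Proof. exact: big_set1. Qed.

Lemma verticesS X Y : X \subset Y -> vertices G X \subset vertices G Y.
Proof.
move=> /subsetP XY; apply/bigcupsP => e /XY eY; exact: bigcup_sup eY.
Qed.

Lemma ends_vertices e X : e \in X -> ends G e \subset vertices G X.
Proof. by move=> eX; apply: bigcup_sup eX. Qed.

Lemma oriented_ends d : is_oriented G d -> ends G (edge_of d) = [set tail d; head d].
Proof. by move/eqP. Qed.

Lemma walk_edges_cons d p : walk_edges (d :: p) = edge_of d |: walk_edges p.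
Proof. by apply/setP => e; rewrite !inE. Qed.

Lemma walk_edges_cat p q : walk_edges (p ++ q) = walk_edges p :|: walk_edges q.
Proof. by apply/setP => e; rewrite !inE map_cat mem_cat. Qed.

Lemma walk_edges_rev p : walk_edges (rev (map flip p)) = walk_edges p.
Proof. by apply/setP => e; rewrite !inE map_rev mem_rev -map_comp. Qed.

Lemma mem_vertices_walk u p v x : walk G u p v ->
  (x \in vertices G (walk_edges p)) =
  (x \in tails p) || (x \in heads p).
Proof.
elim: p u => [|d p IH] u.
  by rewrite /walk_edges /vertices big1 ?inE // => e; rewrite inE.
rewrite /= => /and3P [od _ /IH xp].
rewrite walk_edges_cons verticesU vertices1 (oriented_ends od) !inE xp.
by rewrite -!orbA; congr (_ || _); rewrite orbCA.
Qed.

(** The empty walk is excluded because it visits [u] but has no edge to contribute a vertex. *)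
Lemma vertices_path u p v x : walk G u p v -> p != [::] ->
  (x \in vertices G (walk_edges p)) = (x \in u :: heads p).
Proof.
move=> pw; rewrite (mem_vertices_walk _ pw).
case: p pw => // d p /= /and3P [_ /eqP <- /walk_heads hp] _.
rewrite hp !in_cons mem_rcons in_cons -orbA; congr (_ || _).
by rewrite orbCA orbb.
Qed.

Lemma vertices_closed u p x : walk G u p u ->
  (x \in vertices G (walk_edges p)) = (x \in tails p).
Proof.
move=> pw; rewrite (mem_vertices_walk _ pw).
case: p pw => // d p /= /and3P [_ /eqP <- /walk_heads hp].
by rewrite hp mem_rcons orbb.
Qed.

Lemma card_walk_edges p : uniq (edges p) -> #|walk_edges p| = size p.
Proof. by move=> up; rewrite /walk_edges cardsE (card_uniqP up) size_map. Qed.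

(** The first edge contains [u], which the rest of the path avoids, so that edge cannot recur. *)
Lemma path_uniq_edges u p v : walk G u p v -> uniq (u :: heads p) ->
  uniq (edges p).
Proof.
elim: p u => //= d p IH u /and3P [od /eqP tu pw] /and3P [uhp hd up].
rewrite (IH _ pw) ?andbT /= ?hd //; apply/negP => dp.
have := mem_vertices_walk u pw.
have -> : u \in vertices G (walk_edges p).
  have de : edge_of d \in walk_edges p by rewrite inE.
  by apply: (subsetP (ends_vertices de)); rewrite (oriented_ends od) tu set21.
have := walk_heads pw => /(congr1 (fun s => u \in s)); rewrite (negPf uhp).
rewrite mem_rcons inE => /esym/norP [_ /negPf->].
by move: uhp; rewrite inE => /norP [_ /negPf->].
Qed.

(** Rotate the closed walk so that it starts at [x]. *)
Lemma closed_at C x : is_cycle G C -> x \in vertices G C ->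
  exists p, [/\ walk G x p x, p != [::], uniq (tails p),
    uniq (edges p) & walk_edges p = C].
Proof.
move=> [p [p0 [u pw] ut ue] <-]; rewrite (vertices_closed _ pw) => xp.
have [p1 [d [p2 [ep w1 w2]]]] := walk_split pw xp; exists ((d :: p2) ++ p1); split=> //.
- by apply/walk_cat; exists u.
- by rewrite map_cat uniq_catC -map_cat -ep.
- by rewrite map_cat uniq_catC -map_cat -ep.
- by rewrite ep !walk_edges_cat setUC.
Qed.

Lemma card_vertices_cycle C : is_cycle G C -> #|vertices G C| = #|C|.
Proof.
move=> [p [_ [u pw] ut ue] <-]; rewrite card_walk_edges //.
rewrite -(size_map (@tail V E)) -(card_uniqP ut); apply: eq_card => x.
by rewrite (vertices_closed _ pw).
Qed.

Lemma is_path_sym u v P : is_path G u v P -> is_path G v u P.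
Proof.
move=> [p [pw up <-]]; exists (rev (map flip p)); split; last exact: walk_edges_rev.
  exact: walk_rev.
rewrite -map_rev -map_comp -[map _ _]/(tails _) map_rev.
by rewrite -rev_rcons -(walk_heads pw) rev_uniq.
Qed.

Lemma card_path u v P : is_path G u v P -> u != v ->
  (#|vertices G P| <= #|P|.+1)%N.
Proof.
move=> [p [pw up <-]] uv; rewrite (card_walk_edges (path_uniq_edges pw up)).
have p0 : p != [::] by case: p pw {up} => //= /eqP e; rewrite e eqxx in uv.
have <- : #|u :: heads p| = (size p).+1 by rewrite (card_uniqP up) /= size_map.
by apply: subset_leq_card; apply/subsetP => x; rewrite (vertices_path _ pw p0).
Qed.

End Walks.

(** * Handcuffs and thetas: edge counts and existence *)

Section Bicyclic.
Variables (V E : finType) (G : multigraph V E).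
Local Notation oedge := (oriented_edge V E).
Local Notation tails := (map (@tail V E)).
Local Notation heads := (map (@head V E)).
Local Notation edges := (map (@edge_of V E)).
Implicit Types (d : oedge) (p q : seq oedge) (C P X Y : {set E}) (u v w x : V).

(** Minimality makes the joining path edge-disjoint from both cycles. Each cycle has as many edges
    as vertices, and the path adds at most one interior vertex fewer than it has edges. *)
Lemma loose_handcuff_card C1 C2 C :
  loose_handcuff G C1 C2 C -> #|vertices G C| < #|C|.
Proof.
move=> [P [[c1 c2] dV [u [v [u1 v2 [p [pw up eP]]]]] minP ->]].
have V12 : [disjoint C1 & C2].
  apply/pred0P => e /=; apply/negP => /andP [e1 e2].
  have [x xe] := ends_inhabited G e.
  have := disjointFr dV (subsetP (ends_vertices G e1) _ xe).
  by rewrite (subsetP (ends_vertices G e2) _ xe).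
have ue := path_uniq_edges pw up.
have dP : [disjoint C1 :|: C2 & P].
  apply/pred0P => e /=; apply/negP => /andP [eC]; rewrite -eP inE => /mapP [d dp ed].
  case/splitPr: dp pw up eP ue => p1 p2 /walk_cat [w w1 /and3P [od /eqP tw w2]] up eP ue.
  have := ue; rewrite map_cat cat_uniq /= => /and3P [_ /norP [d1 _] /andP [d2 _]].
  have eE := oriented_ends od.
  have sub : uniq (u :: heads p1) /\ uniq (head d :: heads p2).
    by move: up; rewrite map_cat -cat_cons cat_uniq => /and3P [-> _ /= ->].
  have eP' : edge_of d \in P by rewrite -eP inE map_cat mem_cat /= inE eqxx orbT.
  (* If the edge lies in [C1], the part of the path after it already joins the cycles; if in [C2],
     the part before it does. By minimality that part is all of [P], yet it misses the edge. *)
  case/setUP: eC => eC; have := ends_vertices G eC;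
    rewrite ed eE subUset !sub1set => /andP [tC hC].
    have s2 : walk_edges p2 \subset P.
      by rewrite -eP walk_edges_cat walk_edges_cons setUA subsetUr.
    have h : walk_edges p2 = P.
      by apply: minP s2; exists (head d), v; split=> //; exists p2; case: sub.
    by move: eP'; rewrite -h inE (negPf d2).
  have s1 : walk_edges p1 \subset P by rewrite -eP walk_edges_cat subsetUl.
  have h : walk_edges p1 = P.
    by apply: minP s1; exists u, (tail d); split=> //; exists p1; rewrite tw; case: sub.
  by move: eP'; rewrite -h inE (negPf d1).
rewrite [X in _ < X]cardsU (disjoint_setI0 dP) cards0 subn0 cardsU (disjoint_setI0 V12).
rewrite cards0 subn0 -(card_vertices_cycle c1) -(card_vertices_cycle c2).
rewrite -eP card_walk_edges // eP !verticesU.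
have [d [p' ep]] : exists d p', p = d :: p'.
  case: p pw {up eP ue} => [/eqP uv|d p' _]; last by exists d, p'.
  by rewrite -uv (disjointFr dV u1) in v2.
have sV : vertices G C1 :|: vertices G C2 :|: vertices G P \subset
    vertices G C1 :|: vertices G C2 :|: [set x in tails p'].
  rewrite subUset subsetUl /=; apply/subsetP => x.
  rewrite -eP (vertices_path _ pw); last by rewrite ep.
  rewrite (walk_heads pw) ep !inE mem_rcons !inE.
  have <- : u = tail d by move: pw; rewrite ep => /and3P [_ /eqP].
  by case/or3P => [/eqP->|/eqP->|->]; rewrite ?u1 ?v2 ?orbT.
apply: leq_ltn_trans (subset_leq_card sV) _; rewrite cardsU.
apply: leq_ltn_trans (leq_subr _ _) _; rewrite [#|_ :|: _|]cardsU.
rewrite -addnS; apply: leq_add; first exact: leq_subr.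
by rewrite cardsE ep /= ltnS -(size_map (@tail V E)) card_size.
Qed.

Lemma handcuff_card C1 C2 C : handcuff G C1 C2 C -> #|vertices G C| < #|C|.
Proof.
case=> [[c1 c2 dE cV ->]|]; last exact: loose_handcuff_card.
rewrite verticesU !cardsU cV disjoint_setI0 // cards0 subn0.
rewrite !card_vertices_cycle // subn1 prednK // addn_gt0.
by case: c1 => p [p0 _ _ ue] <-; rewrite card_walk_edges // lt0n size_eq0 p0.
Qed.

(** Three paths give at most three more vertices than edges, and counting the shared [u] and [v]
    only once removes four. *)
Lemma theta_card C : is_theta G C -> #|vertices G C| < #|C|.
Proof.
move=> [u [v [P [uv pP dP vP ->]]]].
rewrite !big_ord_recl big_ord0 /= setU0 !verticesU !cardsU.
set i0 := ord0; set i1 := lift _ _; set i2 := lift _ _.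
have [n01 n02 n12] : [/\ i0 != i1, i0 != i2 & i1 != i2] by [].
rewrite !setIUr (disjoint_setI0 (dP _ _ n01)) (disjoint_setI0 (dP _ _ n02)).
rewrite (disjoint_setI0 (dP _ _ n12)) setU0 cards0 !subn0.
rewrite (vP _ _ n01) (vP _ _ n02) (vP _ _ n12) setUid cards2 uv /=.
have h0 := card_path (pP i0) uv; have h1 := card_path (pP i1) uv.
have h2 := card_path (pP i2) uv.
(* These two bounds keep the truncated subtractions exact. *)
have g1 : 2 <= #|vertices G (P i1)|.
  by rewrite -[2]/((true : nat).+1) -uv -cards2 -(vP _ _ n01) subset_leq_card // subsetIr.
have g2 : 2 <= #|vertices G (P i2)|.
  by rewrite -[2]/((true : nat).+1) -uv -cards2 -(vP _ _ n02) subset_leq_card // subsetIr.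
move: h0 h1 h2 g1 g2.
move: #|vertices G (P i0)| #|vertices G (P i1)| #|vertices G (P i2)| => a b c.
move: #|P i0| #|P i1| #|P i2| => k l m ak bl cm b2 c2.
rewrite addnBA; last exact: leq_trans c2 (leq_addl _ _).
rewrite -subnDA ltn_subLR; last first.
  by rewrite (leq_trans (leq_add b2 c2)) // leq_addl.
apply: leq_ltn_trans (leq_add ak (leq_add bl cm)) _.
by rewrite !addSn !addnS.
Qed.

(* Leave [u] along [e] and keep extending the path until it meets [B] or itself. *)
Lemma lollipop (J : {set E}) (B : {set V}) :
  (forall x e, x \notin B -> e \in J -> x \in ends G e ->
     exists e', [/\ e' \in J, e' != e & x \in ends G e']) ->
  forall u e, e \in J -> u \in ends G e ->
  exists p d, [/\ walk G u (rcons p d) (head d), uniq (u :: heads p),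
    uniq (edges (rcons p d)), walk_edges (rcons p d) \subset J
    & (forall x, x \in heads p -> x \notin B) /\
      ((head d \in B) || (head d \in u :: heads p))].
Proof.
move=> deg u e0 e0J ue0.
(* The path [p] built so far ends at [w], [e] is the next edge, and [n] bounds the remaining steps:
   a path visits [size p + 1] distinct vertices. *)
suff main n p w e : walk G u p w -> uniq (u :: heads p) -> uniq (edges p) ->
    walk_edges p \subset J -> (forall x, x \in heads p -> x \notin B) ->
    #|V| <= size p + n -> e \in J -> e \notin edges p -> w \in ends G e ->
    exists p d, [/\ walk G u (rcons p d) (head d), uniq (u :: heads p),
      uniq (edges (rcons p d)), walk_edges (rcons p d) \subset J
      & (forall x, x \in heads p -> x \notin B) /\
        ((head d \in B) || (head d \in u :: heads p))].
  apply: (main #|V| [::] u e0) => //=.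
  by apply/subsetP => e; rewrite inE.
elim: n p w e => [|n IH] p w e pw up ue pJ pB le_n eJ ep we.
  have := leq_trans (max_card (mem (u :: heads p))) le_n.
  by rewrite (card_uniqP up) /= size_map addn0 ltnn.
have [d [od ed tw]] := orientation_at we.
have pw' : walk G u (rcons p d) (head d) by rewrite walk_rcons od tw pw eqxx.
have ue' : uniq (edges (rcons p d)) by rewrite map_rcons rcons_uniq ed ep.
have pJ' : walk_edges (rcons p d) \subset J.
  apply/subsetP => e'; rewrite inE map_rcons mem_rcons inE ed => /predU1P [->//|e'p].
  by apply: (subsetP pJ); rewrite inE.
have [done|] := boolP ((head d \in B) || (head d \in u :: heads p)).
  by exists p, d; split.
rewrite negb_or => /andP [dB dp].
have [|e' [e'J e'e de']] := deg (head d) e dB eJ.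
  by rewrite -ed (oriented_ends od) set22.
apply: (IH (rcons p d) (head d) e') => //.
- by rewrite map_rcons -rcons_cons rcons_uniq dp.
- by move=> x; rewrite map_rcons mem_rcons inE => /predU1P [->|/pB].
- by rewrite size_rcons addSnnS.
(* Were [e'] already used, [head d] would be a vertex of the old path. *)
rewrite map_rcons mem_rcons inE ed (negPf e'e) /=; apply/negP => e'p.
have e'w : e' \in walk_edges p by rewrite inE.
have := subsetP (ends_vertices G e'w) _ de'.
by rewrite (vertices_path _ pw) ?(negPf dp) //; case: (p) e'p.
Qed.

(** Cutting at the earlier visit to [head d] separates the stick [p1] from the cycle [p2]. *)
Lemma lollipop_cycle u p d : walk G u (rcons p d) (head d) ->
  uniq (u :: heads p) -> uniq (edges (rcons p d)) -> head d \in u :: heads p ->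
  exists p1 p2, [/\ rcons p d = p1 ++ p2, walk G u p1 (head d),
    walk G (head d) p2 (head d), uniq (u :: heads p1)
    & simple_closed_walk G p2 /\ tails p2 \subset u :: heads p].
Proof.
move=> pw up ue dp.
have tE : u :: heads p = tails (rcons p d).
  by move: pw; rewrite walk_rcons => /andP [/walk_heads -> _]; rewrite map_rcons.
move: dp; rewrite tE => /(walk_split pw) [p1 [d' [p2 [ep w1 w2]]]].
have td : tail d' = head d by case/and3P: w2 => _ /eqP.
exists p1, (d' :: p2); split=> //.
  rewrite (walk_heads w1); move: up; rewrite tE ep map_cat cat_uniq /= td rcons_uniq.
  by case/and3P => -> /norP [-> _] _.
split; last by apply/subsetP => x; rewrite ep map_cat mem_cat => ->; rewrite orbT.
split=> //; first by exists (head d).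
  by move: up; rewrite tE ep map_cat cat_uniq => /and3P [].
by move: ue; rewrite ep map_cat cat_uniq => /and3P [].
Qed.

(** The vertices [u] and [x] cut the cycle into two arcs, which together with [P] are the three
    paths of a theta. *)
Lemma cycle_path_theta C u x P : is_cycle G C -> u \in vertices G C ->
  x \in vertices G C -> u != x -> is_path G u x P -> [disjoint C & P] ->
  vertices G P :&: vertices G C = [set u; x] -> is_theta G (C :|: P).
Proof.
move=> cC uC xC ux pP dCP vP.
have [p [pw p0 ut ue eC]] := closed_at cC uC.
move: xC; rewrite -eC (vertices_closed _ pw) => /(walk_split pw) [q1 [d [q2' [ep w1 w2]]]].
set q2 := d :: q2' in ep w2.
have td : tail d = x by case/and3P: w2 => _ /eqP.
have q10 : q1 != [::] by case: (q1) w1 => //= /eqP ux'; rewrite ux' eqxx in ux.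
have ut1 : u \in tails q1.
  by case: (q1) q10 w1 => //= d' q _ /and3P [_ /eqP <- _]; rewrite inE eqxx.
have := ut; rewrite ep map_cat cat_uniq => /and3P [t1 /hasPn t12 t2].
have xt2 : x \in tails q2 by rewrite /= inE td eqxx.
have P0 : is_path G u x (walk_edges q1).
  exists q1; split=> //; rewrite (walk_heads w1) rcons_uniq t1 andbT; exact: t12.
have P1 : is_path G u x (walk_edges q2).
  apply: is_path_sym; exists q2; split=> //; rewrite (walk_heads w2) rcons_uniq t2 andbT.
  by apply/negP => /t12; rewrite /= ut1.
have v1 y : (y \in vertices G (walk_edges q1)) = (y == x) || (y \in tails q1).
  by rewrite (vertices_path _ w1) // (walk_heads w1) mem_rcons inE.
have v2 y : (y \in vertices G (walk_edges q2)) = (y == u) || (y \in tails q2).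
  by rewrite (vertices_path _ w2) // (walk_heads w2) mem_rcons inE.
have v12 : vertices G (walk_edges q1) :&: vertices G (walk_edges q2) = [set u; x].
  apply/setP => y; rewrite !inE v1 v2.
  have [->|yu] := eqVneq y u; first by rewrite ut1 orbT.
  have [->|yx] := eqVneq y x; first by rewrite xt2.
  by rewrite /=; apply/negP => /andP [y1 /t12]; rewrite /= y1.
have e12 : C = walk_edges q1 :|: walk_edges q2 by rewrite -eC ep walk_edges_cat.
have s1 : walk_edges q1 \subset C by rewrite e12 subsetUl.
have s2 : walk_edges q2 \subset C by rewrite e12 subsetUr.
have d12 : [disjoint walk_edges q1 & walk_edges q2].
  move: ue; rewrite ep map_cat cat_uniq => /and3P [_ /hasPn h _].
  by apply/pred0P => e; rewrite /= !inE; apply/negP => /andP [e1 /h]; rewrite /= e1.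
have vQ (Q : {set E}) : Q \subset C -> [set u; x] \subset vertices G Q ->
    vertices G Q :&: vertices G P = [set u; x].
  move=> QC uxQ; apply/eqP; rewrite eqEsubset subsetI uxQ -{2}vP subsetIl andbT.
  by rewrite -vP setIC setIS // verticesS.
have vq1 : vertices G (walk_edges q1) :&: vertices G P = [set u; x].
  by apply: vQ => //; rewrite -v12 subsetIl.
have vq2 : vertices G (walk_edges q2) :&: vertices G P = [set u; x].
  by apply: vQ => //; rewrite -v12 subsetIr.
have dq1 := disjointWl s1 dCP; have dq2 := disjointWl s2 dCP.
(* The default value of [nth] supplies the third path. *)
pose Q (i : 'I_3) := nth P [:: walk_edges q1; walk_edges q2] i.
exists u, x, Q; split=> //.
- by case=> [[|[|[|]]]].
- case=> [[|[|[|]]] hi] // [[|[|[|]]] hj] // nij; rewrite /Q /=;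
    by [] || by rewrite disjoint_sym.
- case=> [[|[|[|]]] hi] // [[|[|[|]]] hj] // nij; rewrite /Q /=;
    by [] || by rewrite setIC.
by rewrite walk_edges_cat !big_ord_recl big_ord0 /Q /= setU0 setUA.
Qed.

(** With an empty target set, the growing path can only stop by meeting itself. *)
Lemma exists_cycle (I : {set E}) e : e \in I ->
  (forall x e, e \in I -> x \in ends G e ->
     exists e', [/\ e' \in I, e' != e & x \in ends G e']) ->
  exists2 C, is_cycle G C & C \subset I.
Proof.
move=> eI deg.
have [u ue] := ends_inhabited G e.
have [|p [d [pw up ued pI []]]] := @lollipop I set0 _ u e eI ue.
  by move=> x e' _; apply: deg.
rewrite inE /= => _ dp.
have [p1 [p2 [ep _ _ _ [c2 _]]]] := lollipop_cycle pw up ued dp.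
exists (walk_edges p2); first by exists p2.
by apply: subset_trans pI; rewrite ep walk_edges_cat subsetUr.
Qed.

(** Grow a path from [u] outside [C1]. Reaching [C1] at another vertex gives a theta, returning to
    [u] a tight handcuff, and closing up at another vertex of the path a loose one. *)
Lemma exists_bicycle (I C1 : {set E}) e u :
  is_cycle G C1 -> C1 \subset I -> e \in I :\: C1 -> u \in ends G e ->
  u \in vertices G C1 ->
  (forall x e, e \in I -> x \in ends G e ->
     exists e', [/\ e' \in I, e' != e & x \in ends G e']) ->
  exists2 C, is_handcuff G C \/ is_theta G C & C \subset I.
Proof.
move=> c1 C1I eI ue uC deg.
have [|p [d [pw up ued pI [pB dB]]]] := @lollipop (I :\: C1) (vertices G C1) _ u e eI ue.
  move=> x e' xB /setDP [e'I _] /(deg x e' e'I) [e'' [e''I ne xe'']].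
  exists e''; split=> //; rewrite inE e''I andbT.
  by apply: contra xB => e''C; apply: subsetP (ends_vertices G e''C) _ xe''.
have dC : [disjoint C1 & walk_edges (rcons p d)].
  by rewrite disjoint_sym; apply: disjointWl pI _; rewrite disjoints_subset setDE subsetIr.
have sI : walk_edges (rcons p d) \subset I by apply: subset_trans pI (subsetDl _ _).
have [dp|dp] := boolP (head d \in u :: heads p); last first.
  have dC1 : head d \in vertices G C1 by move: dB; rewrite (negPf dp) orbF.
  exists (C1 :|: walk_edges (rcons p d)); last by rewrite subUset C1I.
  right; apply: (@cycle_path_theta C1 u (head d)) => //.
  - by apply: contraNneq dp => <-; rewrite inE eqxx.
  - by exists (rcons p d); split=> //; rewrite map_rcons -rcons_cons rcons_uniq dp.
  apply/setP => x; rewrite !inE (vertices_path _ pw); last by case: (p).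
  rewrite inE map_rcons mem_rcons inE.
  have [->|xu] := eqVneq x u; first by rewrite uC.
  have [->|xd] := eqVneq x (head d); first by rewrite dC1.
  by rewrite /=; apply/negP => /andP [/pB /negP].
have [p1 [p2 [ep w1 w2 u1 [c2 t2]]]] := lollipop_cycle pw up ued dp.
set C2 := walk_edges p2.
have cC2 : is_cycle G C2 by exists p2.
have C2I : C2 \subset walk_edges (rcons p d) by rewrite ep walk_edges_cat subsetUr.
have vC2 x : x \in vertices G C2 -> x \in u :: heads p.
  by rewrite (vertices_closed _ w2) => /(subsetP t2).
have dVC2 : head d \in vertices G C2.
  rewrite (vertices_closed _ w2); case: c2 => p20 _ _ _.
  by case: (p2) p20 w2 => //= d' p' _ /and3P [_ /eqP <- _]; rewrite inE eqxx.
have [hdu|hdu] := eqVneq u (head d).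
  exists (C1 :|: C2); last by rewrite subUset C1I (subset_trans C2I).
  left; exists C1, C2; left; split=> //; first exact: disjointWr C2I dC.
  rewrite -(cards1 u); apply: eq_card => x; rewrite !inE.
  have [->|xu] := eqVneq x u; first by rewrite uC hdu.
  by apply/negP => /andP [x1 /vC2]; rewrite inE (negPf xu) => /pB /negP.
have u2 : u \notin vertices G C2.
  (* The stick is nonempty and starts at [u]; since all tails are distinct, the cycle cannot pass
     through [u]. *)
  apply: contra_neqN hdu; rewrite (vertices_closed _ w2) => ut.
  have : uniq (tails (p1 ++ p2)).
    rewrite -ep map_rcons; move: pw; rewrite walk_rcons => /andP [/walk_heads <- _] //.
  rewrite map_cat cat_uniq => /and3P [_ /hasPn h _].
  move: w1 (h _ ut); case: (p1) => [/eqP//|d' p1' /= /and3P [_ /eqP-> _]].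
  by rewrite inE eqxx.
have dV : [disjoint vertices G C1 & vertices G C2].
  apply/pred0P => x /=; apply/negP => /andP [x1 x2]; move: (vC2 _ x2).
  by rewrite inE => /predU1P [xu|/pB /negP //]; rewrite -xu x2 in u2.
(* A minimal joining path inside [p1] is enough; it need not be [p1] itself. *)
have j1 : `[< joining_path G C1 C2 (walk_edges p1) >].
  by apply/asboolP; exists u, (head d); split=> //; exists p1.
have [P /minsetP [/asboolP jP minP] sP] :=
  minset_exists (P := fun Q => `[< joining_path G C1 C2 Q >]) j1.
exists (C1 :|: C2 :|: P).
  left; exists C1, C2; right; exists P; split=> // Q jQ QP; apply: minP => //; exact/asboolP.
rewrite !subUset C1I (subset_trans C2I) //= (subset_trans sP) // (subset_trans _ sI) //.
by rewrite ep walk_edges_cat subsetUl.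
Qed.

End Bicyclic.

(** * Vertex potentials under a group action *)

Section Potentials.
Variables (V E : finType) (G : multigraph V E) (gT : groupType) (T : Type).
Variable act : gT -> T -> T.
Hypothesis act1 : forall x, act 1%g x = x.
Hypothesis actM : forall g h x, act (g * h)%g x = act g (act h x).
Variable psi : oriented_edge V E -> gT.
Implicit Types (d : oriented_edge V E) (p : seq (oriented_edge V E)) (y : V -> T).

(** The action is left abstract: the linear one describes left kernel vectors of the matrix for [N],
    the affine one describes spanning of the top row. *)
Definition compatible y d : Prop := y (tail d) = act (psi d) (y (head d)).

Lemma walk_compatible y u p v : walk G u p v ->
  (forall d, d \in p -> compatible y d) ->
  y u = act (\prod_(d <- p) psi d)%g (y v).
Proof.
elim: p u => [|d p IH] u /=; first by rewrite big_nil act1 => /eqP->.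
move=> /and3P [_ /eqP <- pw] cp; rewrite big_cons actM -(IH _ pw).
  by apply: cp; rewrite inE eqxx.
by move=> d' d'p; apply: cp; rewrite inE d'p orbT.
Qed.

(** Work backwards from [v]: each tail is new, so its value may be set as its edge dictates. The
    values off the tails, in particular at [v], stay prescribed by [y0]. *)
Lemma compatible_path_exists (y0 : V -> T) u p v : walk G u p v ->
  uniq (map (@tail V E) p) -> v \notin map (@tail V E) p ->
  exists2 y, (forall x, x \notin map (@tail V E) p -> y x = y0 x)
    & forall d, d \in p -> compatible y d.
Proof.
elim: p u => [|d p IH] u /=; first by exists y0.
move=> /and3P [_ /eqP tu pw] /andP [td up]; rewrite inE => /norP [vd vp].
have [y yE cy] := IH _ pw up vp.
have hE x : x \in head d :: map (@head V E) p -> x != tail d.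
  rewrite (walk_heads pw) mem_rcons inE => /predU1P [->//|xp].
  by apply: contraNneq td => <-.
exists (fun x => if x == tail d then act (psi d) (y (head d)) else y x).
  by move=> x; rewrite inE => /norP [/negPf-> xp]; rewrite yE.
move=> d'; rewrite inE /compatible => /predU1P [->|d'p].
  by rewrite eqxx (negPf (hE _ _)) // inE eqxx.
rewrite !ifN ?cy //; last by apply: contraNneq td => <-; apply: map_f.
by apply: hE; rewrite inE map_f ?orbT.
Qed.

(** Solve along all edges but the first, with value [c] at [u]; the first edge then demands
    precisely that the total gain fix [c]. *)
Lemma compatible_closed_exists u p c : walk G u p u ->
  uniq (map (@tail V E) p) -> act (\prod_(d <- p) psi d)%g c = c ->
  exists2 y, y u = c & forall d, d \in p -> compatible y d.
Proof.
case: p => [|d p] /=; first by exists (fun=> c).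
move=> /and3P [_ /eqP tu pw] /andP [td up] cc.
rewrite tu in td; have [y yE cy] := compatible_path_exists (fun=> c) pw up td.
have yu : y u = c by rewrite yE.
exists y => // d'; rewrite inE => /predU1P [->|/cy//].
by rewrite /compatible tu (walk_compatible pw cy) yu -actM; move: cc; rewrite big_cons => ->.
Qed.

Hypothesis psi_gain : is_gain_function G psi.

(** Reversing a non-loop inverts its gain, which inverts the relation; a loop is its own
    reversal. *)
Lemma compatible_orientation y d d' : is_oriented G d -> is_oriented G d' ->
  edge_of d' = edge_of d -> compatible y d -> compatible y d'.
Proof.
case: d => [[e t] h] od od' ed cd.
have [->//|->] := oriented_eqVflip od od' ed.
rewrite /flip /edge_of /tail /head /=.
have [th|th] := eqVneq t h; first by rewrite -th in cd *.
move: cd; rewrite /compatible (psi_gain od th) /tail /head /= => ->.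
by rewrite -actM mulgV act1.
Qed.

End Potentials.

(** * The gain matrix and its circuits *)

Section AffineGains.
Local Open Scope ring_scope.
Variables (F : fieldType) (V E : finType) (G : multigraph V E).
Variables (psi : oriented_edge V E -> affine F) (D : E -> V * V).
Hypothesis psi_gain : is_gain_function G psi.
Hypothesis D_orient : is_orientation G D.
Implicit Types (e : E) (v u : V) (C X I : {set E}).

Definition affine_act (g : affine F) (x : F) := trans_part g + mult_part g * x.
(** The action of the quotient by the translations, hence the one that governs [N]. *)
Definition linear_act (g : affine F) (x : F) := mult_part g * x.

Lemma affine_act1 x : affine_act 1%g x = x.
Proof. by rewrite /affine_act /trans_part /mult_part /= add0r mul1r. Qed.

Lemma affine_actM g h x : affine_act (g * h)%g x = affine_act g (affine_act h x).
Proof. by rewrite /affine_act mult_partM mulrDr addrA mulrA. Qed.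

Lemma linear_act1 x : linear_act 1%g x = x.
Proof. by rewrite /linear_act /mult_part /= mul1r. Qed.

Lemma linear_actM g h x : linear_act (g * h)%g x = linear_act g (linear_act h x).
Proof. by rewrite /linear_act mult_partM mulrA. Qed.

Let oD e : oriented_edge V E := (e, (D e).1, (D e).2).
(** The matrix without its row [v_0]. *)
Let entry v e := gain_entry D psi (Some v) e.

(** Loops and non-loops give the same formula, so [y] annihilates column [e] exactly when it is a
    linear potential there. *)
Lemma sum_gain_entry (y : V -> F) e :
  \sum_v y v * entry v e = y (D e).1 - mult_part (psi (oD e)) * y (D e).2.
Proof.
rewrite /entry /gain_entry /oD; case: (D e) => v w /=.
have [->|vw] := eqVneq v w.
  rewrite (bigD1 w) //= eqxx big1 ?addr0; last by move=> u /negPf->; rewrite mulr0.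
  by rewrite mulrBr mulr1 mulrC.
rewrite (bigD1 v) //= eqxx (bigD1 w) /= 1?eq_sym // (negPf vw) eqxx.
rewrite big1 ?addr0; last by move=> u /andP [/negPf-> /negPf->]; rewrite mulr0.
by rewrite mulr1 mulrN mulrC.
Qed.

Lemma ends_orientation e : ends G e = [set (D e).1; (D e).2].
Proof. exact/eqP/(D_orient e). Qed.

Lemma gain_entry_out v e : v \notin ends G e -> entry v e = 0.
Proof.
rewrite ends_orientation !inE /entry /gain_entry.
by case: (D e) => a b /= /norP [/negPf-> /negPf->]; case: eqP.
Qed.

Lemma balanced_quotientP C :
  balanced_cycle G (quotient_gain (translations F) psi) C <->
  exists p, [/\ simple_closed_walk G p, walk_edges p = C
              & mult_part (\prod_(d <- p) psi d)%g = 1].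
Proof.
have prodE p : (\prod_(d <- p) quotient_gain (translations F) psi d)%g =
    quotient_proj (translations F) (\prod_(d <- p) psi d)%g.
  elim: p => [|d p IH]; first by rewrite !big_nil.
  by rewrite !big_cons IH; apply: quotient_projM.
have oneP g : quotient_proj (translations F) g = 1%g <-> mult_part g = 1.
  split=> [/esym/quotient_projP|g1].
    by rewrite /coset_eq invg1 mul1g inE => /eqP.
  by apply/esym/quotient_projP; rewrite /coset_eq invg1 mul1g inE g1.
split=> -[p [pc pC pb]]; exists p; split=> //.
  by apply/oneP; rewrite -prodE.
by rewrite prodE; apply/oneP.
Qed.

(** At an end of [e] the entry is [1], [-b] or, for a loop, [1 - b]; only the last can vanish, and
    then the loop is balanced. *)
Lemma gain_entry_neq0 v e : v \in ends G e ->
  ~ balanced_cycle G (quotient_gain (translations F) psi) [set e] ->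
  entry v e != 0.
Proof.
rewrite ends_orientation !inE => ve nb; apply/eqP => v0; apply: nb.
have := D_orient e; move: ve v0; rewrite /entry /gain_entry.
case: (D e) => a b /=; have [<-|ab] := eqVneq a b; last first.
  have [_ _ /eqP|_ /= ->] := eqVneq v a; first by rewrite oner_eq0.
  by move/eqP; rewrite oppr_eq0 (negPf (mult_part_neq0 _)).
rewrite orbb => -> /eqP; rewrite subr_eq0 eq_sym => /eqP b1 oe.
apply/balanced_quotientP; exists [:: (e, a, a)]; split=> //.
- by split=> //; exists a; rewrite /= oe /= eqxx.
- by apply/setP => e'; rewrite !inE.
by rewrite big_seq1.
Qed.

Lemma dependent_vertices C :
  dependent entry (vertices G C) C -> dependent entry V C.
Proof.
move=> [z nz z0]; exists z => // v _.
have [/z0//|vC] := boolP (v \in vertices G C).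
apply: big1 => e eC; rewrite gain_entry_out ?mul0r //.
by apply: contra vC; apply: subsetP (ends_vertices G eC) _.
Qed.

Lemma sum_vertices (y : V -> F) C e : e \in C ->
  \sum_(v in vertices G C) entry v e * y v = \sum_v y v * entry v e.
Proof.
move=> eC; rewrite [LHS]big_mkcond; apply: eq_bigr => v _.
case: ifPn => [_|vC]; first by rewrite mulrC.
rewrite gain_entry_out ?mulr0 //.
by apply: contra vC; apply: subsetP (ends_vertices G eC) _.
Qed.

Lemma compatible_walk_edges (act : affine F -> F -> F) y p u v :
  (forall x, act 1%g x = x) ->
  (forall g h x, act (g * h)%g x = act g (act h x)) ->
  walk G u p v -> (forall d, d \in p -> compatible act psi y d) ->
  forall e, e \in walk_edges p -> compatible act psi y (oD e).
Proof.
move=> a1 aM pw cp e; rewrite inE => /mapP [d dp ->].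
exact: (compatible_orientation a1 aM psi_gain (walk_oriented pw dp)
          (D_orient _) erefl (cp d dp)).
Qed.

Lemma N_circuit_dependent C :
  N_circuit G (translations F) psi C -> dependent entry V C.
Proof.
move=> NC; apply: dependent_vertices; case: NC.
- move=> /balanced_quotientP [p [pc pC p1]].
  have cC : is_cycle G C by exists p.
  apply: dependent_tr; first by rewrite card_vertices_cycle.
  case: pc => p0 [u pw] ut _.
  (* A multiplicative gain of one fixes every scalar; starting from [1] makes the potential
     nonzero. *)
  have [|y yu cy] := compatible_closed_exists linear_act1 linear_actM (psi := psi) (c := 1) pw ut.
    by rewrite /linear_act p1 mulr1.
  exists y.
    exists u; last by rewrite yu oner_eq0.
    rewrite -pC (vertices_closed _ pw); case: (p) p0 pw => //= d p' _.
    by case/and3P => _ /eqP <- _; rewrite inE eqxx.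
  move=> e eC; rewrite sum_vertices // sum_gain_entry.
  rewrite -pC in eC.
  have := compatible_walk_edges linear_act1 linear_actM pw cy eC.
  by rewrite /compatible /linear_act /tail /head /= => ->; rewrite subrr.
- by move=> [C1 [C2 [h _ _]]]; apply: dependent_card; apply: handcuff_card h.
- by move=> [h _]; apply: dependent_card; apply: theta_card.
Qed.

Lemma dependent_N_circuit X : dependent entry V X ->
  exists2 C, N_circuit G (translations F) psi C & C \subset X.
Proof.
move=> [z [e1 e1X ze1] z0]; apply: contrapT => noC.
(* Assuming [X] contains no circuit of [N], every cycle in the support [I] is unbalanced. *)
pose I := [set e in X | z e != 0].
have IX : I \subset X by apply/subsetP => e; rewrite inE => /andP [].
have noN C : C \subset I -> ~ N_circuit G (translations F) psi C.
  by move=> CI NC; apply: noC; exists C => //; apply: subset_trans IX.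
have nob C : C \subset I -> ~ balanced_cycle G (quotient_gain (translations F) psi) C.
  by move=> CI bC; apply: (noN _ CI); apply: Or31.
have sumI v : \sum_(e in X) entry v e * z e = \sum_(e in I) entry v e * z e.
  rewrite (bigID (fun e => z e != 0)) /= [X in _ + X]big1 ?addr0.
    by apply: eq_bigl => e; rewrite inE.
  by move=> e /andP [_]; rewrite negbK => /eqP->; rewrite mulr0.
(* If [e] were the only edge of [I] at [x], row [x] of the dependency would be a single nonzero
   product. *)
have deg x e : e \in I -> x \in ends G e ->
    exists e', [/\ e' \in I, e' != e & x \in ends G e'].
  move=> eI xe; apply: contrapT => no.
  have /eqP := z0 x isT; rewrite sumI (bigD1 e) //= big1 ?addr0.
    rewrite mulf_eq0; case/orP; apply/negP; last by move: eI; rewrite inE => /andP [].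
    by apply: gain_entry_neq0 => //; apply: nob; rewrite sub1set.
  move=> e' /andP [e'I ne]; rewrite gain_entry_out ?mul0r //.
  by apply/negP => xe'; apply: no; exists e'.
have e1I : e1 \in I by rewrite inE e1X.
have [C1 c1 C1I] := exists_cycle e1I deg.
(* Otherwise [z] restricts to a dependency on the square block of [C1]. Its left kernel then holds a
   linear potential that is nonzero at some [v], and going round from [v] shows that [C1] is
   balanced. *)
have [e [u [eI ue uC]]] : exists e u, [/\ e \in I :\: C1, u \in ends G e & u \in vertices G C1].
  apply: contrapT => no.
  have : dependent (fun e v => entry v e) C1 (vertices G C1).
    apply: dependent_tr; first by rewrite card_vertices_cycle.
    exists z.
      have [p [p0 _ _ _] pC] := c1; case: p p0 pC => // d p _ pC.
      have dC : edge_of d \in C1 by rewrite -pC inE /= inE eqxx.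
      by exists (edge_of d) => //; have := subsetP C1I _ dC; rewrite inE => /andP [].
    move=> v vC; rewrite -[RHS](z0 v isT) sumI [RHS](bigID (mem C1)) /=.
    rewrite [X in _ = _ + X]big1 ?addr0.
      by apply: eq_bigl => e; have [/(subsetP C1I)->|] := boolP (e \in C1); rewrite ?andbF.
    move=> e /andP [eI eC]; rewrite gain_entry_out ?mul0r //.
    by apply/negP => ve; apply: no; exists e, v; rewrite inE eC eI.
  move=> [y [v vC yv] y0].
  have [p [pw p0 ut ue pC]] := closed_at c1 vC.
  apply: (nob _ C1I); apply/balanced_quotientP; exists p; split=> //.
    by split=> //; exists v.
  have := walk_compatible linear_act1 linear_actM (psi := psi) (y := y) pw.
  rewrite /linear_act => h; apply: (mulIf yv); rewrite mul1r -h // => d dp.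
  have dC : edge_of d \in C1 by rewrite -pC inE map_f.
  apply: (compatible_orientation linear_act1 linear_actM psi_gain (D_orient (edge_of d))) => //.
    exact: walk_oriented pw dp.
  apply/eqP; rewrite -subr_eq0 /tail /head /= -[X in _ == X](y0 _ dC).
  by rewrite sum_vertices // sum_gain_entry.
have [C hC CI] := exists_bicycle c1 C1I eI ue uC deg.
apply: (noN C CI); case: hC => [[B1 [B2 h]]|tC].
  apply: Or32; exists B1, B2; suff [s1 s2] : B1 \subset I /\ B2 \subset I.
    by split=> //; apply: nob.
  case: h CI => [[_ _ _ _ ->]|[P [_ _ _ _ ->]]]; rewrite !subUset.
    by case/andP.
  by case/andP => /andP [].
by apply: Or33; split=> // C' _ C'C; apply: nob; apply: subset_trans CI.
Qed.

(** For an edge from [v] to [w] with gain [(a, b)], the equation [a = y v - b * y w] says that the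
    gain maps [y w] to [y v]. *)
Lemma top_row_spanned_compatible C :
  top_row_spanned (gain_entry D psi) C <->
  exists y, forall d, is_oriented G d -> edge_of d \in C ->
    compatible affine_act psi y d.
Proof.
have cE y e : gain_entry D psi None e = \sum_v y v * entry v e <->
    compatible affine_act psi y (oD e).
  rewrite sum_gain_entry /compatible /affine_act /tail /head /oD /gain_entry /=.
  case: (D e) => v w /=; split=> [->|->]; first by rewrite subrK.
  by rewrite addrK.
split=> -[y h]; exists y.
  move=> d od /h /cE.
  exact: (compatible_orientation affine_act1 affine_actM psi_gain (D_orient _)).
by move=> e eC; apply/cE; apply: h => //; apply: D_orient.
Qed.

Lemma selected_circuitP C : N_circuit G (translations F) psi C ->
  selected_circuit G (translations F) (@point_stabilizers F) psi C <->
  top_row_spanned (gain_entry D psi) C.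
Proof.
move=> NC; split=> [[_ sC]|/top_row_spanned_compatible [y cy]].
  apply/top_row_spanned_compatible; case: sC => [[p [[_ [u pw] ut _] pC p1]]|].
    have [|y _ cy] := compatible_closed_exists affine_act1 affine_actM (psi := psi) (c := 0) pw ut.
      by rewrite p1 affine_act1.
    exists y => d od; rewrite -pC.
    move=> /(compatible_walk_edges affine_act1 affine_actM pw cy).
    exact: (compatible_orientation affine_act1 affine_actM psi_gain (D_orient _)).
  (* The switched gains fix [x]; undoing the switching moves this constant potential to [eta v]
     applied to [x]. *)
  move=> [_ [eta [S [[x ->] h]]]]; exists (fun v => affine_act (eta v) x) => d od dC.
  have := h d od dC; rewrite inE => /eqP; rewrite -/(affine_act _ _) /switch => hx.
  by rewrite /compatible -{1}hx -!affine_actM !mulgA mulgV mul1g.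
have sw : exists (eta : V -> affine F) (S : {pred affine F}),
    point_stabilizers S /\ forall d, is_oriented G d -> edge_of d \in C ->
    switch eta psi d \in S.
  (* Translation by [y v] sends [0] to the potential at [v], so the switched gains fix [0]. *)
  pose eta v := mk_affine (y v) (oner_neq0 F).
  have etaE v : affine_act (eta v) 0 = y v by rewrite /affine_act mulr0 addr0.
  exists eta, (stabilizer 0); split; first by exists 0.
  move=> d od dC; rewrite inE -/(affine_act _ _) /switch !affine_actM etaE.
  by rewrite -(cy d od dC) -[y _]etaE -affine_actM mulVg affine_act1.
split=> //; case: (NC) => [/balanced_quotientP [p [pc pC p1]]|[C1 [C2 [h _ _]]]|[h _]].
- left; exists p; split=> //; case: pc => _ [u pw] _ _.
  have := walk_compatible affine_act1 affine_actM pw (psi := psi) (y := y).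
  rewrite /affine_act p1 mul1r => h.
  (* The total gain is a translation fixing [y u], so its translation part is zero. *)
  apply: aff_eq; last by rewrite p1.
  apply: (addIr (y u)); rewrite -h ?add0r // => d dp; apply: cy.
    exact: walk_oriented pw dp.
  by rewrite -pC inE map_f.
- by right; split=> //; left; exists C1, C2.
- by right; split=> //; right.
Qed.

Lemma vector_rank_gain_matrix X :
  vector_rank (gain_matrix D psi) X =
  \rank (submat (gain_entry D psi) {: option V} X).
Proof. by congr mxrank; apply/matrixP => i j; rewrite !mxE enum_rankK. Qed.

End AffineGains.

Theorem theorem5p6 (F : fieldType) (V E : finType) (G : multigraph V E)
    (psi : oriented_edge V E -> affine F) (D : E -> V * V) :
  is_gain_function G psi -> is_orientation G D ->
  represents (gain_matrix D psi)
    (M_rank G (translations F) (@point_stabilizers F) psi).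
Proof.
move=> gpsi oD X; rewrite vector_rank_gain_matrix.
(* Both ranks now have the same form, so it remains to compare the two tests on circuits of [N]. *)
rewrite (rank_circuits (circuit := N_circuit G (translations F) psi)).
- congr (if _ then _ else _); apply: asbool_equiv_eq.
  by split=> h C NC CX; apply/(selected_circuitP gpsi oD NC); apply: h.
- exact: N_circuit_dependent.
- exact: dependent_N_circuit.
Qed.
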